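(* Assume that $\begin{pmatrix}Q&L'\\L&R\end{pmatrix}$ is positive definite. Let $\mathcal{U}\subset S^n_{++}$ be an open set such that $\lambda\,\mathcal{U}\subset\mathcal{U}$ for all $\lambda\in(0,1]$. Assume that there is $P_0\in S^n_{++}$ such that $P\leq P_0$ for all $P\in\mathcal{U}$, and let $\alpha=m\big((Q-L'R^{-1}L)/P_0\big)$. Then for all $P_1,P_2\in\mathcal{U}$, $$d_T(M_t(P_1),M_t(P_2))\leq e^{-\alpha t}\,d_T(P_1,P_2),\qquad 0\leq t<\min\{t_{\mathcal{U}}(P_1),t_{\mathcal{U}}(P_2)\}.$$
   Context: $S^n$ is the set of real symmetric $n\times n$ matrices, $S^n_{++}$ the positive definite ones; $\leq$ is the Loewner order; $'$ denotes transpose. For $X\in S^n$, $Y\in S^n_{++}$, $M(X/Y)=\inf\{t\in\mathbb{R}:X\leq tY\}$, $m(X/Y)=\sup\{t\in\mathbb{R}:X\geq tY\}$; the Thompson metric is $d_T(X,Y)=\log\max\{M(X/Y),M(Y/X)\}$ on $S^n_{++}$. $A,C\in\mathbb{R}^{n\times n}$, $B,D\in\mathbb{R}^{n\times k}$, $L\in\mathbb{R}^{k\times n}$, $Q\in S^n$, $R\in S^k$ are constant matrices, and $$\phi(P)=A'P+PA+C'PC+Q-(B'P+D'PC+L)'(R+D'PD)^{-1}(B'P+D'PC+L),\quad P\in S^n_{++}.$$ $M_t(P)$ is the value at time $t$ of the maximal solution in $S^n_{++}$ of $\dot P=\phi(P)$ with initial value $P$ at time $0$, defined on $[0,a)$;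 for $P\in\mathcal{U}$, $t_{\mathcal{U}}(P)=\sup\{b\in(0,a):M_t(P)\in\mathcal{U}\ \forall t\in[0,b)\}$. *)

(* Defs.v *)
From HB Require Import structures.
From mathcomp Require Import all_boot all_order all_algebra.
From mathcomp Require Import all_classical all_reals all_analysis.

Set Implicit Arguments.
Unset Strict Implicit.
Unset Printing Implicit Defensive.

Import Order.TTheory GRing.Theory Num.Theory.
Import numFieldNormedType.Exports.

Local Open Scope classical_set_scope.
Local Open Scope ring_scope.

Definition symmx (K : realType) (n : nat) : set 'M[K]_n :=
  [set X | X \is symmetricmx].

Definition psdmx (K : realType) (n : nat) : set 'M[K]_n :=
  [set X | symmx X /\ forall v : 'cV[K]_n, 0 <= (v^T *m X *m v) 0 0].

Definition pdmx (K : realType) (n : nat) : set 'M[K]_n :=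
  [set X | symmx X /\ forall v : 'cV[K]_n, v != 0 -> 0 < (v^T *m X *m v) 0 0].

Definition loewner_le (K : realType) (n : nat) (X Y : 'M[K]_n) : Prop :=
  psdmx (Y - X).

Definition gaugeM (K : realType) (n : nat) (X Y : 'M[K]_n) : K :=
  inf [set t : K | loewner_le X (t *: Y)].

Definition gaugem (K : realType) (n : nat) (X Y : 'M[K]_n) : K :=
  sup [set t : K | loewner_le (t *: Y) X].

Definition thompson (K : realType) (n : nat) (X Y : 'M[K]_n) : K :=
  ln (Num.max (gaugeM X Y) (gaugeM Y X)).

Definition riccati (K : realType) (n k : nat) (A C : 'M[K]_n)
    (B D : 'M[K]_(n, k)) (L : 'M[K]_(k, n)) (Q : 'M[K]_n) (R : 'M[K]_k)
    (P : 'M[K]_n) : 'M[K]_n :=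
  let S := B^T *m P + D^T *m P *m C + L in
  A^T *m P + P *m A + C^T *m P *m C + Q
    - S^T *m invmx (R + D^T *m P *m D) *m S.

(* Solutions live on [0, a), with a possibly infinite; since X is a total
   function, its values outside [0, a) are irrelevant, and the derivative at 0
   is one-sided. *)
Definition is_solution (K : realType) (n : nat) (phi : 'M[K]_n -> 'M[K]_n)
    (P : 'M[K]_n) (a : \bar K) (X : K -> 'M[K]_n) : Prop :=
  [/\ (0 < a)%E,
      X 0 = P,
      forall t : K, 0 <= t -> (t%:E < a)%E -> pdmx (X t),
      h^-1 *: (X h - X 0) @[h --> 0^'+] --> phi (X 0) &
      forall t : K, 0 < t -> (t%:E < a)%E -> is_derive t 1 X (phi (X t))].

Definition is_maximal_solution (K : realType) (n : nat)
    (phi : 'M[K]_n -> 'M[K]_n) (P : 'M[K]_n) (a : \bar K)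
    (X : K -> 'M[K]_n) : Prop :=
  is_solution phi P a X /\
  forall (b : \bar K) (Y : K -> 'M[K]_n), is_solution phi P b Y ->
    (forall t : K, 0 <= t -> (t%:E < a)%E -> Y t = X t) -> (b <= a)%E.

(* A choice of maximal solution. For locally Lipschitz phi and P in the open
   cone it exists and is unique on [0, a) (Picard-Lindelof), so the default,
   which has an empty domain, is not used. *)
Definition maximal_solution (K : realType) (n : nat)
    (phi : 'M[K]_n -> 'M[K]_n) (P : 'M[K]_n) : \bar K * (K -> 'M[K]_n) :=
  xget (0%E, cst P) [set s | is_maximal_solution phi P s.1 s.2].

Definition lifetime (K : realType) (n : nat) (phi : 'M[K]_n -> 'M[K]_n)
    (P : 'M[K]_n) : \bar K :=
  (maximal_solution phi P).1.

Definition flow (K : realType) (n : nat) (phi : 'M[K]_n -> 'M[K]_n)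
    (t : K) (P : 'M[K]_n) : 'M[K]_n :=
  (maximal_solution phi P).2 t.

Definition exit_time (K : realType) (n : nat) (phi : 'M[K]_n -> 'M[K]_n)
    (U : set 'M[K]_n) (P : 'M[K]_n) : \bar K :=
  ereal_sup [set b%:E | b in [set b : K |
    [/\ 0 < b, (b%:E < lifetime phi P)%E &
        forall t : K, 0 <= t < b -> U (flow phi t P)]]].

(* Main.v *)
Require Import Defs.
From HB Require Import structures.
From mathcomp Require Import all_boot all_order all_algebra.
From mathcomp Require Import all_classical all_reals all_analysis.
From mathcomp Require Import ring lra.

(** The contraction estimate says that the order relation
      [X1 s <= exp (d * exp (- alpha * s)) X2 s],
    where [X1] and [X2] are the two trajectories, persists once it holds at
    time 0; in positive dimension, the Thompson metric is the least [d] for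
    which this and the relation with [X1] and [X2] exchanged hold at the
    initial values.

    Write [y s = d * exp (- alpha * s)] and [G = exp y *: X2 - X1].  By
    continuity, [G] can leave the positive definite cone only through a time at
    which it is positive semidefinite with a kernel vector [v] other than 0, and
    then the derivative of [v^T G v] cannot be positive ([pdmx_barrier]).  It
    is positive, however, because the Riccati operator is a minimum of affine
    maps: [v^T phi(P) v] is the minimum over control vectors [u] of
      [2 v^T P w + z^T P z + cost v u],  [w = A v + B u],  [z = C v + D u]
    ([riccati_square]), and [cost v u >= v^T q v] for the Schur complement
    [q = Q - L^T R^-1 L], which is positive definite ([reduced_cost_le],
    [reduced_cost_gt0]).  Take [u] optimal for [X2]; it is only a competitor
    for [X1].  In [v^T G' v] the terms in [w] cancel since [G v = 0], the terms
    in [z] add up to [z^T G z >= 0], and the costs leave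
    [(exp y - 1) * cost v u], at least [(exp y - 1) * v^T q v].  The factor
    [exp y] contributes [- alpha * y * v^T X1 v], which is at least
    [- y * v^T q v], since [alpha P0 <= q] and [X1 <= P0].  The sum is at least
    [(exp y - 1 - y) * v^T q v > 0] ([riccati_tangency]). *)

Set Implicit Arguments.
Unset Strict Implicit.
Unset Printing Implicit Defensive.

Import Order.TTheory GRing.Theory Num.Theory.
Import numFieldNormedType.Exports.

Local Open Scope classical_set_scope.
Local Open Scope ring_scope.

(** * Bilinear forms of matrices and definiteness *)

Definition bil (K : realType) (m n : nat) (X : 'M[K]_(m, n))
    (v : 'cV[K]_m) (w : 'cV[K]_n) : K :=
  (v^T *m X *m w) 0 0.

Section Bilinear.
Variable K : realType.
Implicit Types m n p : nat.

Lemma bilDl m n (X : 'M[K]_(m, n)) v v' w :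
  bil X (v + v') w = bil X v w + bil X v' w.
Proof. by rewrite /bil linearD /= !mulmxDl mxE. Qed.

Lemma bilDr m n (X : 'M[K]_(m, n)) v w w' :
  bil X v (w + w') = bil X v w + bil X v w'.
Proof. by rewrite /bil mulmxDr mxE. Qed.

Lemma bilZl m n (X : 'M[K]_(m, n)) a v w : bil X (a *: v) w = a * bil X v w.
Proof. by rewrite /bil linearZ /= -!scalemxAl mxE. Qed.

Lemma bilZr m n (X : 'M[K]_(m, n)) a v w : bil X v (a *: w) = a * bil X v w.
Proof. by rewrite /bil -scalemxAr mxE. Qed.

Lemma bilD m n (X Y : 'M[K]_(m, n)) v w :
  bil (X + Y) v w = bil X v w + bil Y v w.
Proof. by rewrite /bil mulmxDr mulmxDl mxE. Qed.

Lemma bilN m n (X : 'M[K]_(m, n)) v w : bil (- X) v w = - bil X v w.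
Proof. by rewrite /bil mulmxN mulNmx mxE. Qed.

Lemma bilB m n (X Y : 'M[K]_(m, n)) v w :
  bil (X - Y) v w = bil X v w - bil Y v w.
Proof. by rewrite bilD bilN. Qed.

Lemma bilZ m n a (X : 'M[K]_(m, n)) v w : bil (a *: X) v w = a * bil X v w.
Proof. by rewrite /bil -scalemxAr -scalemxAl mxE. Qed.

Lemma bil0r m n (X : 'M[K]_(m, n)) v : bil X v 0 = 0.
Proof. by rewrite /bil mulmx0 mxE. Qed.

Lemma bil_mulr m n p (X : 'M[K]_(m, n)) (Y : 'M[K]_(n, p)) v w :
  bil (X *m Y) v w = bil X v (Y *m w).
Proof. by rewrite /bil !mulmxA. Qed.

Lemma bil_mull m n p (X : 'M[K]_(m, n)) (Y : 'M[K]_(n, p)) v w :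
  bil (X *m Y) v w = bil Y (X^T *m v) w.
Proof. by rewrite /bil trmx_mul trmxK !mulmxA. Qed.

Lemma bil_cong m n p (X : 'M[K]_(m, n)) (P : 'M[K]_m) (Y : 'M[K]_(m, p)) v w :
  bil (X^T *m P *m Y) v w = bil P (X *m v) (Y *m w).
Proof. by rewrite bil_mulr bil_mull trmxK. Qed.

Lemma bil_tr m n (X : 'M[K]_(m, n)) v w : bil X^T v w = bil X w v.
Proof.
have -> : bil X w v = (w^T *m X *m v)^T 0 0 by rewrite mxE.
by rewrite !trmx_mul trmxK mulmxA.
Qed.

Lemma symmx_tr n (X : 'M[K]_n) : symmx X -> X^T = X.
Proof.
move=> /is_hermitianmxP; rewrite expr0 scale1r => {2}->.
by apply/matrixP => i j; rewrite !mxE.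
Qed.

Lemma tr_symmx n (X : 'M[K]_n) : X^T = X -> symmx X.
Proof.
move=> XT; apply/is_hermitianmxP; rewrite expr0 scale1r -{1}XT.
by apply/matrixP => i j; rewrite !mxE.
Qed.

Lemma bilC n (X : 'M[K]_n) v w : symmx X -> bil X v w = bil X w v.
Proof. by move=> sX; rewrite -{1}(symmx_tr sX) bil_tr. Qed.

Lemma symmxZ n a (X : 'M[K]_n) : symmx X -> symmx (a *: X).
Proof. by move=> /symmx_tr sX; apply: tr_symmx; rewrite linearZ /= sX. Qed.

Lemma symmxB n a (X Y : 'M[K]_n) : symmx X -> symmx Y -> symmx (a *: X - Y).
Proof.
move=> /symmx_tr sX /symmx_tr sY; apply: tr_symmx.
by rewrite linearB linearZ /= sX sY.
Qed.

Lemma loewnerP n (X Y : 'M[K]_n) : symmx X -> symmx Y ->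
  loewner_le X Y <-> forall v, bil X v v <= bil Y v v.
Proof.
move=> sX sY; split.
  by move=> [_ le] v; have := le v; rewrite -/(bil _ v v) bilB subr_ge0.
move=> le; split; last by move=> v; rewrite -/(bil _ v v) bilB subr_ge0.
by rewrite -[Y]scale1r; apply: symmxB.
Qed.

Lemma pdmx_ge0 n (X : 'M[K]_n) v : pdmx X -> 0 <= bil X v v.
Proof.
move=> [_ pX]; have [->|/pX/ltW//] := eqVneq v 0.
by rewrite bil0r.
Qed.

(** A vector in the kernel would annihilate the quadratic form. *)
Lemma pdmx_unit n (X : 'M[K]_n) : pdmx X -> X \in unitmx.
Proof.
move=> [sX pX]; rewrite -row_free_unit -kermx_eq0.
apply/eqP/row_matrixP => i; rewrite row0; apply/eqP; apply: contraT => nz.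
have /pX : (row i (kermx X))^T != 0 by rewrite -(trmx0 _ 1 n) (can_eq trmxK).
have /sub_kermxP eq0 := row_sub i (kermx X).
by rewrite trmxK eq0 mul0mx mxE ltxx.
Qed.

(** Cauchy-Schwarz for a semidefinite form: an isotropic vector lies in the
    kernel, for otherwise the form at [w + r v] would be affine and nonconstant
    in [r] and would take negative values. *)
Lemma psd_null n (X : 'M[K]_n) v w : symmx X ->
  (forall z, 0 <= bil X z z) -> bil X v v = 0 -> bil X v w = 0.
Proof.
move=> sX psd v0; apply/eqP; apply: contraT => nz.
(* The value of the form at this point is [- bil X w w - 2]. *)
have := psd (w + (- (bil X w w + 1) / bil X v w) *: v).
rewrite !(bilDl, bilDr, bilZl, bilZr) v0 (bilC w v sX).
have -> : - (bil X w w + 1) / bil X v w * bil X v w = - (bil X w w + 1).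
  by field.
by have := psd w; lra.
Qed.

(** Completion of the square: for [w = N^-1 b] with [N] positive definite it
    shows that [u = - w] minimizes [u^T N u + 2 u^T b].  It serves for the
    running cost and for the Riccati operator. *)
Lemma square_shift n (N : 'M[K]_n) u w : symmx N ->
  bil N u u + 2 * bil N u w = bil N (u + w) (u + w) - bil N w w.
Proof. by move=> sN; rewrite !(bilDl, bilDr) (bilC w u sN); ring. Qed.

End Bilinear.

(** * The Riccati operator as a minimum of affine maps *)

Section Riccati.
Variables (K : realType) (n k : nat).
Variables (A C : 'M[K]_n) (B D : 'M[K]_(n, k)) (L : 'M[K]_(k, n)).
Variables (Q : 'M[K]_n) (R : 'M[K]_k).
Hypotheses (sQ : symmx Q) (sR : symmx R) (hQLR : pdmx (block_mx Q L^T L R)).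

(** The running cost of the linear-quadratic control problem whose value
    function satisfies the Riccati equation, with state [v] and control [u]. *)
Definition cost (v : 'cV[K]_n) (u : 'cV[K]_k) : K :=
  bil Q v v + 2 * bil L u v + bil R u u.

Lemma cost_block v u :
  cost v u = bil (block_mx Q L^T L R) (col_mx v u) (col_mx v u).
Proof.
have addE (M N : 'M[K]_1) : (M + N) 0 0 = M 0 0 + N 0 0 by rewrite mxE.
rewrite {1}/bil tr_col_mx mul_row_block mul_row_col !mulmxDl !addE.
by rewrite -!/(bil _ _ _) bil_tr /cost; ring.
Qed.

Lemma weight_pd : pdmx R.
Proof.
split=> // u u0; have [_ /(_ (col_mx 0 u))] := hQLR.
rewrite -!/(bil _ _ _) -cost_block /cost !bil0r mulr0 !add0r; apply.
by rewrite col_mx_eq0 negb_and u0 orbT.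
Qed.

(** The Schur complement of [R] in the cost matrix. *)
Definition reduced_cost : 'M[K]_n := Q - L^T *m invmx R *m L.

(** Completing the square in [u], with minimizer [- R^-1 L v]. *)
Lemma cost_min v u : bil reduced_cost v v =
  cost v u - bil R (u + invmx R *m (L *m v)) (u + invmx R *m (L *m v)).
Proof.
set w := invmx R *m (L *m v).
have Rw z : bil R z w = bil L z v.
  by rewrite /w -!bil_mulr mulmxV ?mul1mx //; apply/pdmx_unit/weight_pd.
have -> : bil reduced_cost v v = bil Q v v - bil R w w.
  by rewrite bilB !bil_mulr -/w bil_tr Rw.
have := square_shift u w sR; rewrite Rw /cost; lra.
Qed.

Lemma reduced_cost_le v u : bil reduced_cost v v <= cost v u.
Proof. by rewrite (cost_min v u) lerBlDr lerDl; apply/pdmx_ge0/weight_pd. Qed.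

(** The Schur complement is the cost of the optimal control, and the cost is
    positive definite in [(v, u)]. *)
Lemma reduced_cost_gt0 v : v != 0 -> 0 < bil reduced_cost v v.
Proof.
move=> v0; rewrite (cost_min v (- (invmx R *m (L *m v)))) addNr.
rewrite bil0r subr0 cost_block; have [_] := hQLR; apply.
by rewrite col_mx_eq0 negb_and v0.
Qed.

Lemma reduced_cost_sym : symmx reduced_cost.
Proof.
apply: tr_symmx; rewrite linearB /= !trmx_mul trmxK (symmx_tr sQ) trmx_inv.
by rewrite (symmx_tr sR) mulmxA.
Qed.

(** The minimizer of the Hamiltonian over the controls. *)
Definition feedback (P : 'M[K]_n) (v : 'cV[K]_n) : 'cV[K]_k :=
  - (invmx (R + D^T *m P *m D) *m ((B^T *m P + D^T *m P *m C + L) *m v)).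

(** With [w = A v + B u] the drift and [z = C v + D u] the diffusion of the
    controlled system, this is the Hamiltonian of the value function [P].  It is
    affine in [P] for fixed [v] and [u], which is what the comparison of two
    trajectories exploits. *)
Definition hamiltonian (P : 'M[K]_n) (v : 'cV[K]_n) (u : 'cV[K]_k) : K :=
  2 * bil P v (A *m v + B *m u) + bil P (C *m v + D *m u) (C *m v + D *m u)
  + cost v u.

Lemma control_weight_pd P : pdmx P -> pdmx (R + D^T *m P *m D).
Proof.
move=> pP; have [sP _] := pP; split.
  apply: tr_symmx; rewrite linearD /= !trmx_mul trmxK (symmx_tr sP).
  by rewrite (symmx_tr sR) mulmxA.
move=> u u0; rewrite -/(bil _ _ _) bilD bil_cong.
apply: ltr_wpDr; first exact: pdmx_ge0.
by have [_] := weight_pd; apply.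
Qed.

(** The square is nonnegative and vanishes at the feedback, so
    [v^T phi(P) v] is the minimum of the Hamiltonian over the controls. *)
Lemma riccati_square P v u : pdmx P ->
  bil (riccati A C B D L Q R P) v v = hamiltonian P v u
    - bil (R + D^T *m P *m D) (u - feedback P v) (u - feedback P v).
Proof.
move=> pP; have [sP _] := pP; rewrite /riccati /feedback opprK.
have [sN _] := control_weight_pd pP.
have uN := pdmx_unit (control_weight_pd pP).
set S := B^T *m P + D^T *m P *m C + L.
set N := R + D^T *m P *m D in sN uN *.
set w := invmx N *m (S *m v).
have Nw z : bil N z w = bil S z v by rewrite /w -!bil_mulr mulmxV ?mul1mx.
have Sw z : bil S z v = bil P v (B *m z) + bil P (C *m v) (D *m z) + bil L z v.
  rewrite /S !bilD bil_cong bil_mull trmxK.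
  by rewrite (bilC _ v) // (bilC (D *m z)).
have Nuu : bil N u u = bil R u u + bil P (D *m u) (D *m u).
  by rewrite bilD bil_cong.
have -> :
  bil (A^T *m P + P *m A + C^T *m P *m C + Q - S^T *m invmx N *m S) v v =
  2 * bil P v (A *m v) + bil P (C *m v) (C *m v) + bil Q v v - bil N w w.
  have -> : bil N w w = bil (S^T *m invmx N *m S) v v.
    by rewrite Nw -bil_tr !bil_mulr.
  rewrite bilB !bilD bil_cong (bil_mull A^T) trmxK bil_mulr (bilC (A *m v)) //.
  ring.
have := square_shift u w sN; rewrite (Nw u) Sw Nuu /hamiltonian /cost.
rewrite !(bilDl, bilDr) (bilC (D *m u) (C *m v) sP); lra.
Qed.

End Riccati.

(** * Topology of the positive definite cone *)

Section Coercive.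
Variable K : realType.

Lemma bil_sum m n (X : 'M[K]_(m, n)) v w :
  bil X v w = \sum_i \sum_j v i 0 * X i j * w j 0.
Proof.
rewrite /bil mxE exchange_big; apply: eq_bigr => j _.
by rewrite mxE mulr_suml; apply: eq_bigr => i _; rewrite !mxE.
Qed.

Lemma coord_le_norm m n (X : 'M[K]_(m, n)) i j : `|X i j| <= `|X|.
Proof.
rewrite [leRHS]mx_normrE.
by rewrite (le_bigmax _ (fun ij : 'I_m * 'I_n => `|X ij.1 ij.2|) (i, j)).
Qed.

Lemma bil_norm_le n (X : 'M[K]_n) v :
  `|bil X v v| <= n%:R ^+ 2 * `|X| * `|v| ^+ 2.
Proof.
rewrite bil_sum; have sum_const a : \sum_(i < n) a = n%:R * a :> K.
  by rewrite sumr_const card_ord mulr_natl.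
have -> : n%:R ^+ 2 * `|X| * `|v| ^+ 2 =
    \sum_(i < n) \sum_(j < n) `|v| * `|X| * `|v|.
  by rewrite !sum_const; ring.
apply: (le_trans (ler_norm_sum _ _ _)); apply: ler_sum => i _.
apply: (le_trans (ler_norm_sum _ _ _)); apply: ler_sum => j _.
by rewrite !normrM !ler_pM ?mulr_ge0 ?coord_le_norm.
Qed.

Lemma fun_mul_continuous (T : topologicalType) (f g : T -> K) :
  continuous f -> continuous g -> continuous (fun x => f x * g x).
Proof. by move=> cf cg x; apply: cvgM; [exact: cf|exact: cg]. Qed.

Lemma bil_continuous n v w : continuous (fun X : 'M[K]_n => bil X v w).
Proof.
under [X in continuous X]eq_fun do rewrite bil_sum.
apply: (continuous_big add_continuous) => i _.
apply: (continuous_big add_continuous) => j _.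
apply: fun_mul_continuous; last exact: cst_continuous.
by apply: fun_mul_continuous; [exact: cst_continuous|exact: coord_continuous].
Qed.

Lemma quad_continuous n (X : 'M[K]_n) :
  continuous (fun u : 'rV[K]_n => bil X u^T u^T).
Proof.
under [X in continuous X]eq_fun do rewrite bil_sum.
apply: (continuous_big add_continuous) => i _.
apply: (continuous_big add_continuous) => j _.
under [X in continuous X]eq_fun do rewrite !mxE.
apply: fun_mul_continuous; last exact: coord_continuous.
by apply: fun_mul_continuous; [exact: coord_continuous|exact: cst_continuous].
Qed.

Lemma normmx_tr m n (X : 'M[K]_(m, n)) : `|X^T| = `|X|.
Proof.
have le p q (Y : 'M[K]_(p, q)) : `|Y^T| <= `|Y|.
  rewrite [leLHS]mx_normrE bigmax_le // => -[i j] _ /=.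
  by rewrite mxE coord_le_norm.
by apply: le_anti; rewrite le -{1}[X]trmxK le.
Qed.

(** The quadratic form attains a positive minimum on the unit sphere, which is
    compact.  Row vectors are used there because compactness of bounded closed
    sets is a statement about rows. *)
Lemma pdmx_coercive n (X : 'M[K]_n) : pdmx X ->
  exists2 e, 0 < e & forall v, e * `|v| ^+ 2 <= bil X v v.
Proof.
move=> [_ pos].
pose S := [set u : 'rV[K]_n | `|u| = 1].
have scale (v : 'cV[K]_n) : v != 0 -> S (`|v|^-1 *: v)^T.
  move=> v0; rewrite /S /= normmx_tr normrZ normfV normr_id mulVf //.
  by rewrite normr_eq0.
(* The sphere is empty exactly in dimension 0, where any constant works. *)
have [S0|S0] := pselect (S !=set0); last first.
  exists 1 => // v; have [->|/scale Sv] := eqVneq v 0; last first.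
    by exfalso; apply: S0; exists ((`|v|^-1 *: v)^T).
  by rewrite bil0r normr0 expr0n mulr0.
have cS : compact S.
  apply: bounded_closed_compact.
    exists 1; split; first exact: num_real.
    by move=> x x1 u /= ->; rewrite ltW.
  apply: (@preimage_closed _ _ (fun u : 'rV[K]_n => `|u|) [set x | x = 1]).
    by move=> u _; apply: norm_continuous.
  exact: closed_eq.
have [c cinS cmin] := compact_EVT_min S0 cS
  (continuous_subspaceT (@quad_continuous n X)).
exists (bil X c^T c^T).
  apply: pos; apply/eqP => c0; move: cinS; rewrite inE /S /=.
  by rewrite -normmx_tr c0 normr0 => /eqP; rewrite eq_sym oner_eq0.
move=> v; have [->|v0] := eqVneq v 0.
  by rewrite bil0r normr0 expr0n mulr0.
have := cmin _ (mem_set (scale v v0)).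
rewrite trmxK bilZl bilZr mulrA -invfM -expr2 ler_pdivlMl.
  by rewrite mulrC.
by rewrite exprn_gt0 // normr_gt0.
Qed.

(** The cone is open in the symmetric matrices: a perturbation smaller than the
    coercivity constant divided by [n ^ 2] is harmless.  The extra [+ 1] below
    avoids a division by zero in dimension 0. *)
Lemma pdmx_near n (X : 'M[K]_n) : pdmx X ->
  \forall Y \near X, symmx Y -> pdmx Y.
Proof.
move=> pX; have [e e0 eX] := pdmx_coercive pX.
have d0 : 0 < e / (n%:R ^+ 2 + 1).
  by rewrite divr_gt0 // ltr_wpDl // exprn_ge0.
near=> Y => sY; split => // v v0; rewrite -/(bil _ v v).
have -> : bil Y v v = bil X v v - bil (X - Y) v v by rewrite bilB; ring.
rewrite subr_gt0; apply: le_lt_trans (ler_norm _) _.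
apply: le_lt_trans (bil_norm_le _ _) _; apply: lt_le_trans (eX v).
rewrite ltr_pM2r; last by rewrite exprn_gt0 // normr_gt0.
have : `|X - Y| < e / (n%:R ^+ 2 + 1).
  by near: Y; apply: cvgr_dist_lt.
rewrite ltr_pdivlMr; last by rewrite ltr_wpDl // exprn_ge0.
apply: le_lt_trans; rewrite mulrC ler_wpM2l // lerDl //.
Unshelve. all: by end_near. Qed.

Lemma pdmx_dominates n (X Y : 'M[K]_n) : pdmx Y ->
  exists t, forall v, bil X v v <= t * bil Y v v.
Proof.
move=> pY; have [e e0 eY] := pdmx_coercive pY.
exists (n%:R ^+ 2 * `|X| / e) => v.
apply: le_trans (ler_norm _) _; apply: le_trans (bil_norm_le _ _) _.
rewrite -[leRHS]mulrA ler_wpM2l ?mulr_ge0 ?exprn_ge0 //.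
by rewrite ler_pdivlMl.
Qed.

(** A continuous linear functional commutes with the difference quotient. *)
Lemma is_derive_bil n (G : K -> 'M[K]_n) (t : K) (dG : 'M[K]_n) v w :
  is_derive t 1 G dG -> is_derive t 1 (fun s => bil (G s) v w) (bil dG v w).
Proof.
move=> [dvG <-].
have cv : h^-1 *: (bil (G (h *: 1 + t)) v w - bil (G t) v w) @[h --> 0^']
    --> bil ('D_1 G t) v w.
  have -> : (fun h : K => h^-1 *: (bil (G (h *: 1 + t)) v w - bil (G t) v w)) =
    (fun h : K => bil (h^-1 *: (G (h *: 1 + t) - G t)) v w).
    by apply/funext => h; rewrite bilZ bilB.
  by apply: (cvg_comp _ (fun X => bil X v w) dvG); exact: bil_continuous.
apply: DeriveDef; first by apply/cvg_ex; exists (bil ('D_1 G t) v w).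
exact: cvg_lim cv.
Qed.

(** A function that descends to 0 from the left has nonpositive slope there:
    otherwise it would be negative just before. *)
Lemma derive_left_le0 (f : K -> K) (a c d : K) : a < c -> f c = 0 ->
  (forall x, a < x < c -> 0 <= f x) -> is_derive c 1 f d -> d <= 0.
Proof.
move=> ac fc0 fge [dvf <-]; rewrite leNgt; apply/negP => d0.
have /(_ dvf)[/= e e0 he] : derivable f c 1 ->
    \forall h \near 0^', 0 < h^-1 *: (f (h *: 1 + c) - f c).
  by move=> dvf'; exact: cvgr_gt d0.
pose h : K := - (Num.min e (c - a) / 2).
have m0 : 0 < Num.min e (c - a) by rewrite lt_min e0 subr_gt0.
have h0 : h < 0 by rewrite oppr_lt0 divr_gt0.
have mh : Num.min e (c - a) = - 2 * h by rewrite /h; field.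
have he' : - h < e by apply: lt_le_trans (_ : Num.min e (c - a) <= e);
  [rewrite mh; lra | rewrite ge_min lexx].
have ha : - h < c - a by apply: lt_le_trans (_ : Num.min e (c - a) <= c - a);
  [rewrite mh; lra | rewrite ge_min lexx orbT].
have := he h; rewrite /= sub0r normrN ltr0_norm // => /(_ he' (ltr0_neq0 h0)).
rewrite fc0 subr0 [_%:A]mulr1 nmulr_rgt0 ?invr_lt0 // ltNge fge //.
by apply/andP; split; lra.
Qed.
End Coercive.

(** * Invariance of the positive definite cone *)

Section Barrier.
Variables (K : realType) (n : nat).

(** Consider the first time [c] at which [G] fails to be positive definite.
    Right continuity and openness of the cone show that the failure occurs at
    [c] itself and that [0 < c]; left continuity makes [G c] semidefinite.  So
    some [v] has [v^T G(c) v = 0], and the slope of [v^T G v] at [c] is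
    nonpositive, contrary to the tangency hypothesis.  Only the derivatives of
    the quadratic forms enter, which spares differentiating a product of a
    scalar function and a matrix function. *)
Lemma pdmx_barrier (G : K -> 'M[K]_n) (dG : K -> 'cV[K]_n -> K) (T : K) :
  (forall s, 0 <= s <= T -> symmx (G s)) ->
  (forall s, 0 <= s <= T -> G h @[h --> s^'+] --> G s) ->
  (forall s v, 0 < s <= T -> is_derive s 1 (fun r => bil (G r) v v) (dG s v)) ->
  (forall s v, 0 < s <= T -> v != 0 -> (forall w, 0 <= bil (G s) w w) ->
     bil (G s) v v = 0 -> 0 < dG s v) ->
  pdmx (G 0) -> forall s, 0 <= s <= T -> pdmx (G s).
Proof.
move=> sG cG dGP inward pd0 s0 s0T; apply: contrapT => npd0.
pose bad := [set s | 0 <= s <= T /\ ~ pdmx (G s)].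
have bad0 : bad !=set0 by exists s0.
have lb0 : has_lbound bad by exists 0 => s [/andP[]].
pose c := inf bad.
have c0 : 0 <= c by apply: lb_le_inf => // s [/andP[]].
have cbad s : bad s -> c <= s by apply: ge_inf.
have cT : c <= T by apply: le_trans (cbad s0 _) _ => //; case/andP: s0T.
have pd_before s : 0 <= s < c -> pdmx (G s).
  case/andP=> s_ge0 sc; apply: contrapT => npd.
  have : bad s by split=> //; rewrite s_ge0 (le_trans (ltW sc)).
  by move/cbad; rewrite leNgt sc.
have npdc : ~ pdmx (G c).
  move=> pdc; have cI : 0 <= c <= T by rewrite c0.
  have [/= e e0 near_pd] := cG c cI _ (pdmx_near pdc).
  have [s [sI npds] se] := inf_adherent e0 (conj bad0 lb0).
  have cs : c <= s by exact: cbad.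
  have [cs'|sc|sc] := ltgtP c s; last by apply: npds; rewrite -sc.
    apply: npds; apply: near_pd => //; last exact: sG.
    by rewrite /ball_ /= ltr0_norm ?subr_lt0 // opprB ltrBlDl.
  by rewrite leNgt sc in cs.
have c_gt0 : 0 < c.
  by rewrite lt_neqAle c0 andbT; apply/eqP => c0'; apply: npdc; rewrite -c0'.
have cI : 0 < c <= T by rewrite c_gt0.
have psd w : 0 <= bil (G c) w w.
  have dv : derivable (fun r => bil (G r) w w) c 1 by have [] := dGP c w cI.
  have /cvg_at_left_filter lc : {for c, continuous (fun r => bil (G r) w w)}.
    by apply: differentiable_continuous; apply/derivable1_diffP.
  rewrite -(cvg_lim _ lc) //; apply: limr_ge.
    by apply/cvg_ex; eexists; exact: lc.
  near=> s; apply: pdmx_ge0; apply: pd_before; apply/andP; split.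
    by near: s; exact: nbhs_left_ge.
  by near: s; exact: nbhs_left_lt.
apply: npdc; split; first by apply: sG; rewrite c0.
move=> v v0; rewrite lt_neqAle psd andbT; apply/eqP => /esym v_null.
have := inward c v cI v0 psd v_null; apply/negP; rewrite -leNgt.
apply: (derive_left_le0 c_gt0 v_null _ (dGP c v cI)) => x /andP[x0 xc].
by apply: pdmx_ge0; apply: pd_before; rewrite ltW.
Unshelve. all: by end_near. Qed.
End Barrier.

(** * Comparison of two trajectories *)

Section Comparison.
Variables (K : realType) (n k : nat).
Variables (A C : 'M[K]_n) (B D : 'M[K]_(n, k)) (L : 'M[K]_(k, n)).
Variables (Q : 'M[K]_n) (R : 'M[K]_k).
Hypotheses (sQ : symmx Q) (sR : symmx R) (hQLR : pdmx (block_mx Q L^T L R)).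
Let phi := riccati A C B D L Q R.
Let q := reduced_cost L Q R.

(** The positive quantity is [v^T G' v] at a contact time, for
    [G = exp y *: X2 - X1] and [y' = - a * y].  The chain of inequalities reads
    [v^T G' v >= z^T G z + (exp y - 1) * cost v u - y * a * v^T X1 v
    >= (exp y - 1 - y) * v^T q v]. *)
Lemma riccati_tangency (P0 X1 X2 : 'M[K]_n) (a y : K) v :
  pdmx X1 -> pdmx X2 -> (forall w, bil X1 w w <= bil P0 w w) ->
  0 <= a -> (forall w, a * bil P0 w w <= bil q w w) -> 0 < y ->
  v != 0 -> (forall w, 0 <= bil (expR y *: X2 - X1) w w) ->
  bil (expR y *: X2 - X1) v v = 0 ->
  0 < expR y * bil (phi X2) v v + - a * y * expR y * bil X2 v v
      - bil (phi X1) v v.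
Proof.
move=> pX1 pX2 X1P0 a0 aP0 y0 v0 psd v_null.
have [[sX1 _] [sX2 _]] := (pX1, pX2).
pose u := feedback C B D L R X2 v.
have phi2 : bil (phi X2) v v = hamiltonian A C B D L Q R X2 v u.
  by rewrite (riccati_square A C B D sR hQLR v u pX2) subrr bil0r subr0.
have phi1 : bil (phi X1) v v <= hamiltonian A C B D L Q R X1 v u.
  rewrite (riccati_square A C B D sR hQLR v u pX1) lerBlDr lerDl.
  exact: pdmx_ge0 (control_weight_pd D sR hQLR pX1).
(* The contact vector is in the kernel, so the drift terms cancel. *)
have := psd_null (A *m v + B *m u) (symmxB _ sX2 sX1) psd v_null.
have := psd (C *m v + D *m u).
move: phi2 phi1 v_null; rewrite /hamiltonian !(bilB, bilZ).
set z := C *m v + D *m u; set w := A *m v + B *m u.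
have q_pos : 0 < bil q v v := reduced_cost_gt0 sR hQLR v0.
have q_cost : bil q v v <= cost L Q R v u := reduced_cost_le sR hQLR v u.
have y_q : y * (a * bil X1 v v) <= y * bil q v v.
  by rewrite ler_pM2l //; apply: le_trans (aP0 v); rewrite ler_wpM2l.
have exp_y : 1 + y < expR y by apply: expR_gt1Dx; rewrite gt_eqF.
have l_q : (expR y - 1) * bil q v v <= (expR y - 1) * cost L Q R v u.
  by rewrite ler_wpM2l //; lra.
have strict : 0 < (expR y - 1 - y) * bil q v v by rewrite mulr_gt0 //; lra.
move=> -> phi1 v_null psd_z null_w.
have -> : - a * y * expR y * bil X2 v v = - (y * (a * bil X1 v v)).
  have -> : bil X1 v v = expR y * bil X2 v v by lra.
  by ring.
nra.
Qed.

(** The barrier for [exp y *: X2 - X1] with [y s = d * exp (- a * s)], the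
    solution of [y' = - a * y] starting at [d]. *)
Lemma riccati_comparison (P0 : 'M[K]_n) (a d T : K) (X1 X2 : K -> 'M[K]_n) :
  0 <= a -> (forall w, a * bil P0 w w <= bil q w w) -> 0 < d -> 0 <= T ->
  (forall s, 0 <= s <= T -> pdmx (X1 s)) ->
  (forall s, 0 <= s <= T -> pdmx (X2 s)) ->
  (forall s w, 0 <= s <= T -> bil (X1 s) w w <= bil P0 w w) ->
  X1 h @[h --> 0^'+] --> X1 0 -> X2 h @[h --> 0^'+] --> X2 0 ->
  (forall s, 0 < s <= T -> is_derive s 1 X1 (phi (X1 s))) ->
  (forall s, 0 < s <= T -> is_derive s 1 X2 (phi (X2 s))) ->
  pdmx (expR d *: X2 0 - X1 0) ->
  pdmx (expR (d * expR (- a * T)) *: X2 T - X1 T).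
Proof.
move=> a0 aP0 d0 T0 pX1 pX2 X1P0 cX10 cX20 dX1 dX2 init.
pose y (s : K) : K := d * expR (- a * s).
have y_gt0 (s : K) : 0 < y s by rewrite mulr_gt0 // expR_gt0.
have dy (s : K) : is_derive s 1 y (- a * y s).
  have e1 : is_derive s 1 (fun r : K => - a * r) (- a).
    apply: is_derive_eq (is_deriveZ (- a) (is_derive_id s 1)) _.
    exact: mulr1.
  have e2 := is_derive1_comp (is_derive_expR (- a * s)) e1.
  apply: is_derive_eq (is_deriveZ d e2) _.
  by rewrite /y /GRing.scale /=; ring.
have dl (s : K) : is_derive s 1 (expR \o y) (- a * y s * expR (y s)).
  by apply: is_derive_eq (is_derive1_comp _ (dy s)) _; rewrite mulrC.
have right_cont (X : K -> 'M[K]_n) (s : K) : X h @[h --> 0^'+] --> X 0 ->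
    (forall r, 0 < r <= T -> is_derive r 1 X (phi (X r))) ->
    0 <= s <= T -> X h @[h --> s^'+] --> X s.
  move=> cX0 dX /andP[]; rewrite le_eqVlt => /predU1P[<- //|s0 sT].
  have [|dXs _] := dX s; first by rewrite s0.
  apply: cvg_at_right_filter; apply: differentiable_continuous.
  exact/derivable1_diffP.
pose G (s : K) := expR (y s) *: X2 s - X1 s.
pose dG (s : K) v := expR (y s) * bil (phi (X2 s)) v v
  + - a * y s * expR (y s) * bil (X2 s) v v - bil (phi (X1 s)) v v.
apply: (@pdmx_barrier _ _ G dG T).
- by move=> s sI; apply: symmxB; [have [] := pX2 s sI|have [] := pX1 s sI].
- move=> s sI; apply: cvgB; last exact: right_cont.
  apply: cvgZ; last exact: right_cont.
  have cl : {for s, continuous (expR \o y)}.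
    apply: differentiable_continuous.
    by apply/derivable1_diffP; have [] := dl s.
  exact: cvg_at_right_filter cl.
- move=> s v sI.
  have -> : (fun r => bil (G r) v v) = (expR \o y) * (fun r => bil (X2 r) v v)
      - (fun r => bil (X1 r) v v).
    by apply/funext => r; rewrite /G bilB bilZ.
  have d1 := is_derive_bil v v (dX1 s sI).
  have d2 := is_derive_bil v v (dX2 s sI).
  apply: is_derive_eq (is_deriveB (is_deriveM (dl s) d2) d1) _.
  by rewrite /dG /GRing.scale /=; ring.
- move=> s v sI v0 psd v_null; have sI' : 0 <= s <= T.
    by case/andP: sI => /ltW -> ->.
  apply: (@riccati_tangency P0) => //; [exact: pX1|exact: pX2|].
  by move=> w; exact: X1P0.
- by rewrite /G /y mulr0 expR0 mulr1.
- by rewrite T0 lexx.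
Qed.

End Comparison.

(** * The Thompson metric *)

Section Thompson.
Variables (K : realType) (n : nat).
Implicit Types X Y : 'M[K]_n.

Lemma nonzero_col : (0 < n)%N -> exists v : 'cV[K]_n, v != 0.
Proof.
move=> n0; exists (const_mx 1); apply/eqP => /matrixP/(_ (Ordinal n0) 0).
by rewrite !mxE => /eqP; rewrite oner_eq0.
Qed.

(** In positive dimension the defining set is bounded below by 0, hence its
    infimum is a lower bound of it. *)
Lemma gaugeM_le X Y t : (0 < n)%N -> pdmx X -> pdmx Y ->
  (forall v, bil X v v <= t * bil Y v v) -> gaugeM X Y <= t.
Proof.
move=> /nonzero_col[v v0] [sX pX] [sY pY] XtY; apply: ge_inf; last first.
  by apply/(loewnerP sX (symmxZ t sY)) => w; rewrite bilZ.
exists 0 => s /(loewnerP sX (symmxZ s sY))/(_ v); rewrite bilZ => le.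
by have := pX v v0; have := pY v v0; rewrite -!/(bil _ _ _); nra.
Qed.

(** Coercivity of [Y] makes the defining set nonempty, so that some
    [s < t] in it gives [X <= s Y < t Y]. *)
Lemma gaugeM_lt X Y t : pdmx X -> pdmx Y -> gaugeM X Y < t ->
  pdmx (t *: Y - X).
Proof.
move=> pX pY; have [[sX _] [sY posY]] := (pX, pY).
have [s0 Xs0] := pdmx_dominates X pY.
move=> /inf_lt[|s /(loewnerP sX (symmxZ s sY)) Xs st].
  by exists s0; apply/(loewnerP sX (symmxZ s0 sY)) => w; rewrite bilZ.
split; first exact: symmxB.
move=> v /posY; rewrite -!/(bil _ _ _) bilB bilZ => Y0.
by have := Xs v; rewrite bilZ; nra.
Qed.

(** If both gauges were less than 1, then [Y - X] and [X - Y] would both be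
    positive definite. *)
Lemma gaugeM_max_ge1 X Y : (0 < n)%N -> pdmx X -> pdmx Y ->
  1 <= Num.max (gaugeM X Y) (gaugeM Y X).
Proof.
move=> /nonzero_col[v v0] pX pY; rewrite leNgt gt_max; apply/negP => /andP[].
move=> /(gaugeM_lt pX pY)[_ /(_ v v0)] + /(gaugeM_lt pY pX)[_ /(_ v v0)].
by rewrite -!/(bil _ _ _) !bilB !bilZ; lra.
Qed.

Lemma thompson_ge0 X Y : (0 < n)%N -> pdmx X -> pdmx Y -> 0 <= thompson X Y.
Proof. by move=> n0 pX pY; apply/ln_ge0/gaugeM_max_ge1. Qed.

Lemma thompsonC X Y : thompson X Y = thompson Y X.
Proof. by rewrite /thompson maxC. Qed.

Lemma thompson_lt X Y d : (0 < n)%N -> pdmx X -> pdmx Y ->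
  thompson X Y < d -> pdmx (expR d *: Y - X).
Proof.
move=> n0 pX pY; have max_ge1 := gaugeM_max_ge1 n0 pX pY.
rewrite -ltr_expR lnK ?posrE ?(lt_le_trans ltr01) // gt_max => /andP[lt _].
exact: gaugeM_lt.
Qed.

Lemma thompson_le X Y d : (0 < n)%N -> pdmx X -> pdmx Y ->
  (forall v, bil X v v <= expR d * bil Y v v) ->
  (forall v, bil Y v v <= expR d * bil X v v) -> thompson X Y <= d.
Proof.
move=> n0 pX pY XY YX; have max_ge1 := gaugeM_max_ge1 n0 pX pY.
rewrite -ler_expR lnK ?posrE ?(lt_le_trans ltr01) // ge_max.
by rewrite !gaugeM_le.
Qed.

End Thompson.

(** In dimension 0 the gauges are infima of the whole line, which is unbounded:
    they take the default value 0, and so does the logarithm there. *)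
Lemma thompson_dim0 (K : realType) (X Y : 'M[K]_0) : thompson X Y = 0.
Proof.
have gauge0 (Z W : 'M[K]_0) : gaugeM Z W = 0.
  have sym0 (M : 'M[K]_0) : symmx M.
    by apply: tr_symmx; rewrite [LHS]flatmx0 [RHS]flatmx0.
  apply: inf_out => -[_ [m lbm]].
  have : m <= m - 1.
    apply: (lbm (m - 1)) => /=.
    apply/(loewnerP (sym0 Z) (sym0 _)) => v.
    by rewrite (flatmx0 v) !bil0r.
  lra.
by rewrite /thompson !gauge0 maxxx ln0.
Qed.

(** * The flow and the contraction rate *)

Section Flow.
Variables (K : realType) (n : nat) (phi : 'M[K]_n -> 'M[K]_n).

Lemma right_derivative_cvg (X : K -> 'M[K]_n) (l : 'M[K]_n) :
  h^-1 *: (X h - X 0) @[h --> 0^'+] --> l -> X h @[h --> 0^'+] --> X 0.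
Proof.
move=> dX.
have h0 : h @[h --> (0 : K)^'+] --> (0 : K) by exact: cvg_at_right_filter.
have expand : \forall h \near (0 : K)^'+,
    h *: (h^-1 *: (X h - X 0)) + X 0 = X h.
  apply: filterS (nbhs_right_neq 0) => h hn0.
  by rewrite scalerA divff // scale1r subrK.
have := cvgD (cvgZ h0 dX) (cvg_cst (X 0)).
rewrite scale0r add0r => cX.
by refine (cvg_trans (near_eq_cvg expand) _); exact: cX.
Qed.

(** A time before the exit time is before some [b > 0] that precedes the
    lifetime.  The lifetime is then positive, so the chosen maximal solution is
    not the default one and the flow does solve the equation. *)
Lemma flow_before_exit (U : set 'M[K]_n) P t :
  (t%:E < exit_time phi U P)%E -> 0 <= t ->
  [/\ flow phi 0 P = P,
      forall s, 0 <= s <= t -> U (flow phi s P),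
      flow phi h P @[h --> 0^'+] --> flow phi 0 P &
      forall s, 0 < s <= t ->
        is_derive s 1 (flow phi ^~ P) (phi (flow phi s P))].
Proof.
move=> /ereal_sup_gt[_ [b [b0 blife inU] <-]]; rewrite lte_fin => tb t0.
have : is_maximal_solution phi P (lifetime phi P) (flow phi ^~ P).
  move: blife; rewrite /lifetime /flow /maximal_solution.
  case: xgetP => [s _ //|_ /=]; rewrite lte_fin => b_lt0.
  by have := lt_trans b0 b_lt0; rewrite ltxx.
case=> -[_ X0 _ dX0 dX] _; split => //.
- by move=> s /andP[s0 st]; apply: inU; rewrite s0 (le_lt_trans st).
- exact: right_derivative_cvg dX0.
- move=> s /andP[s0 st]; apply: dX => //; apply: lt_trans blife.
  by rewrite lte_fin (le_lt_trans st).
Qed.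

End Flow.

(** The supremum is attained, because the Loewner order is closed: it is a
    family of weak scalar inequalities, one for each vector. *)
Lemma gaugem_ge0 (K : realType) (n : nat) (X Y : 'M[K]_n) :
  (0 < n)%N -> symmx X -> (forall v, 0 <= bil X v v) -> pdmx Y ->
  0 <= gaugem X Y /\ forall v, gaugem X Y * bil Y v v <= bil X v v.
Proof.
move=> n0 sX psd [sY pY].
have inE t : loewner_le (t *: Y) X -> forall v, t * bil Y v v <= bil X v v.
  by move=> /(loewnerP (symmxZ t sY) sX) le v; rewrite -bilZ.
have in0 : loewner_le (0 *: Y) X.
  by apply/(loewnerP (symmxZ 0 sY) sX) => v; rewrite bilZ mul0r.
split=> [|v].
  have [v v0] := nonzero_col K n0; apply: ub_le_sup => //.
  exists (bil X v v / bil Y v v) => t /inE/(_ v).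
  by rewrite ler_pdivlMr //; exact: pY.
have [->|v0] := eqVneq v 0; first by rewrite !bil0r mulr0.
have Y0 : 0 < bil Y v v by exact: pY.
rewrite -ler_pdivlMr //; apply: ge_sup; first by exists 0.
by move=> t /inE; rewrite ler_pdivlMr.
Qed.

Theorem theorem5p3 (K : realType) (n k : nat)
    (A C : 'M[K]_n) (B D : 'M[K]_(n, k)) (L : 'M[K]_(k, n))
    (Q : 'M[K]_n) (R : 'M[K]_k)
    (hQ : symmx Q) (hR : symmx R)
    (hQLR : pdmx (block_mx Q L^T L R))
    (U : set 'M[K]_n)
    (hUpd : U `<=` @pdmx K n)
    (hUopen : exists2 V : set 'M[K]_n, open V & U = V `&` @symmx K n)
    (hUscale : forall (l : K) (P : 'M[K]_n), 0 < l <= 1 -> U P -> U (l *: P))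
    (P0 : 'M[K]_n) (hP0 : pdmx P0)
    (hUP0 : forall P : 'M[K]_n, U P -> loewner_le P P0) :
  let phi := riccati A C B D L Q R in
  let alpha := gaugem (Q - L^T *m invmx R *m L) P0 in
  forall P1 P2 : 'M[K]_n, U P1 -> U P2 ->
  forall t : K, 0 <= t ->
    (t%:E < Order.min (exit_time phi U P1) (exit_time phi U P2))%E ->
    thompson (flow phi t P1) (flow phi t P2)
      <= expR (- alpha * t) * thompson P1 P2.
Proof.
move=> phi alpha P1 P2 UP1 UP2 t t0; rewrite lt_min => /andP[t1 t2].
have [n0|n0] := posnP n.
  move: P1 P2 {UP1 UP2 t1 t2} @phi; subst n => *.
  by rewrite !thompson_dim0 mulr0.
have [alpha0 alphaP0] : 0 <= alpha /\
    forall v, alpha * bil P0 v v <= bil (reduced_cost L Q R) v v.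
  apply: gaugem_ge0 => //; first exact: reduced_cost_sym.
  move=> v; have [->|v0] := eqVneq v 0; first by rewrite bil0r.
  exact/ltW/reduced_cost_gt0.
have [X10 UX1 cX1 dX1] := flow_before_exit t1 t0.
have [X20 UX2 cX2 dX2] := flow_before_exit t2 t0.
have UleP0 P w : U P -> bil P w w <= bil P0 w w.
  move=> UP; have [sP _] := hUpd _ UP; have [sP0 _] := hP0.
  by have /(loewnerP sP sP0) := hUP0 _ UP.
have tI : 0 <= t <= t by rewrite t0 lexx.
have d_ge0 := thompson_ge0 n0 (hUpd _ UP1) (hUpd _ UP2).
(* The barrier needs strict inequality initially, hence a [d] larger than the
   initial distance, by an amount that contributes exactly [e] at time [t]. *)
apply/ler_addgt0Pr => e e0.
pose d := thompson P1 P2 + e / expR (- alpha * t).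
have ee0 : 0 < e / expR (- alpha * t) by rewrite divr_gt0 // expR_gt0.
have d0 : 0 < d by rewrite ltr_wpDl.
have lt_d : thompson P1 P2 < d by rewrite ltrDl.
have -> : expR (- alpha * t) * thompson P1 P2 + e = d * expR (- alpha * t).
  by rewrite /d mulrDl divfK ?gt_eqF ?expR_gt0 // mulrC.
pose r := expR (d * expR (- alpha * t)).
have pd12 : pdmx (r *: flow phi t P2 - flow phi t P1).
  apply: (riccati_comparison hR hQLR alpha0 alphaP0 d0 t0 _ _ _
    cX1 cX2 dX1 dX2).
  - by move=> s /UX1/hUpd.
  - by move=> s /UX2/hUpd.
  - by move=> s w /UX1; exact: UleP0.
  - by rewrite X10 X20; apply: thompson_lt => //; exact: hUpd.
have pd21 : pdmx (r *: flow phi t P1 - flow phi t P2).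
  apply: (riccati_comparison hR hQLR alpha0 alphaP0 d0 t0 _ _ _
    cX2 cX1 dX2 dX1).
  - by move=> s /UX2/hUpd.
  - by move=> s /UX1/hUpd.
  - by move=> s w /UX2; exact: UleP0.
  - rewrite X10 X20; apply: thompson_lt; rewrite // 1?thompsonC //; exact: hUpd.
apply: thompson_le => //; [exact/hUpd/UX1|exact/hUpd/UX2| |].
- by move=> v; have := pdmx_ge0 v pd12; rewrite bilB bilZ subr_ge0.
- by move=> v; have := pdmx_ge0 v pd21; rewrite bilB bilZ subr_ge0.
Qed.
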